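(* For real $d>1$, let \[ \gamma(d):=d^{-d/(d-1)}\bigl(\sinh(d\xi_d)+d\sinh(\xi_d)\bigr), \] where $\xi_d$ is the unique positive root of the equation $\cosh(d\xi_d)=d\cosh(\xi_d)$. Then \[ \gamma(d)=2^{1/d+O((\log d)^2/d^2)} \quad\text{as } d\to\infty, \] that is, there exist constants $C>0$ and $d_0>1$ such that for all real $d\ge d_0$, \[ \Bigl|\log_2\gamma(d)-\frac1d\Bigr|\le C\,\frac{(\log d)^2}{d^2}. \]
   Context: The variable $d$ is a real number tending to infinity (it is not required to be an integer). $\log$ denotes the natural logarithm and $\log_2$ the logarithm to base $2$. *)

(* Defs.v *)
From Stdlib Require Import Reals ClassicalEpsilon.
Open Scope R_scope.

Definition is_xi (d x : R) : Prop := 0 < x /\ cosh (d * x) = d * cosh x.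

(* Description operator: for [1 < d] the value is the root itself, since it
   exists and is unique; for other [d] the value carries no information. *)
Definition xi (d : R) : R := epsilon (inhabits 0) (unique (is_xi d)).

(* [Rpower] is the intended real power here because its base [d] is positive. *)
Definition gamma (d : R) : R :=
  Rpower d (- d / (d - 1)) * (sinh (d * xi d) + d * sinh (xi d)).

Definition log2 (x : R) : R := ln x / ln 2.

(* Main.v *)
Require Import Defs.
From Stdlib Require Import Reals Lra ClassicalEpsilon.
Open Scope R_scope.

(** Existence and uniqueness of the root come from the intermediate value
    theorem and from strict monotonicity: the derivative of
    [cosh (d x) - d cosh x] is [d (sinh (d x) - sinh x)], which is positive for
    [x > 0] as soon as [d > 1].

    For the asymptotics put [x = xi d], [y = d x] and [L = ln d].  The root
    equation [cosh y = d cosh x] turns the sum of hyperbolic sines into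
    exponentials, [sinh y + d sinh x = d e^x - e^(-y)]
    ([sinh_sum_at_root]).  Hence, exactly,
    [ln (gamma d) = x - L / (d - 1) + ln (1 - e^(-y-x) / d)]
    ([ln_gamma_eq]), where the last logarithm is [O(1/d^2)] because
    [e^y >= cosh y >= d].

    Only [x] remains to be located.  The root equation also reads
    [e^y + e^(-y) = 2 d cosh x], and [1 <= cosh x <= e^x], so that [y] lies
    between [ln (2d) - O(1/d^2)] and [ln (2d) + x].  The upper bound first gives
    [x = O(L/d)] and then [y = ln (2d) + O(L/d)] ([root_upper],
    [root_lower]).  Dividing by [d], [x = (ln 2 + L)/d + O(L/d^2)]; the terms
    [L/d] and [L/(d-1)] cancel up to [O(L/d^2)], which leaves
    [ln (gamma d) = ln 2 / d + O(L/d^2)].  This is stronger than required by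
    one factor [L], and [L >= 1] for [d >= 3]. *)

(** * Elementary bounds *)

Lemma cosh_ge_1 (x : R) : 1 <= cosh x.
Proof.
unfold cosh; rewrite exp_Ropp.
assert (He := exp_pos x); set (e := exp x) in *.
apply Rmult_le_reg_r with (2 * e); [lra|].
replace ((e + / e) / 2 * (2 * e)) with (e * e + 1) by (field; lra).
assert (H := Rle_0_sqr (e - 1)); unfold Rsqr in H; lra.
Qed.

Lemma cosh_le_exp (x : R) : 0 <= x -> cosh x <= exp x.
Proof.
intros Hx; unfold cosh.
assert (exp (- x) <= exp x) by (destruct Hx as [Hx | <-];
  [left; apply exp_increasing; lra | rewrite Ropp_0; lra]).
lra.
Qed.

Lemma ln_le_sub_1 (u : R) : 0 < u -> ln u <= u - 1.
Proof.
intros Hu.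
assert (H := exp_ineq1_le (ln u)); rewrite exp_ln in H; lra.
Qed.

Lemma ln_le (a b : R) : 0 < a -> a <= b -> ln a <= ln b.
Proof.
intros Ha [Hab | <-]; [left; apply ln_increasing; assumption | lra].
Qed.

Lemma ln_ge_1 (d : R) : 3 <= d -> 1 <= ln d.
Proof.
intros Hd; rewrite <- (ln_exp 1); apply ln_le; [apply exp_pos|].
assert (H := exp_le_3); lra.
Qed.

Lemma ln_one_sub_ge (t : R) : 0 <= t <= 1 / 2 -> - 2 * t <= ln (1 - t).
Proof.
intros Ht.
assert (H := ln_le_sub_1 (/ (1 - t)) ltac:(apply Rinv_0_lt_compat; lra)).
rewrite ln_Rinv in H by lra.
assert (/ (1 - t) <= 1 + 2 * t); [|lra].
apply Rmult_le_reg_r with (1 - t); [lra|].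
rewrite Rinv_l by lra; nra.
Qed.

(** * The root *)

Definition root_defect (d x : R) : R := cosh (d * x) - d * cosh x.

Lemma root_defect_derivative (d x : R) :
  derivable_pt_lim (root_defect d) x (d * (sinh (d * x) - sinh x)).
Proof.
replace (d * (sinh (d * x) - sinh x))
  with (sinh (d * x) * (d * 1) - d * sinh x) by ring.
apply (derivable_pt_lim_minus (fun x => cosh (d * x)) (fun x => d * cosh x)).
- apply (derivable_pt_lim_comp (fun x => d * x) cosh).
  + apply (derivable_pt_lim_scal id), derivable_pt_lim_id.
  + apply derivable_pt_lim_cosh.
- apply (derivable_pt_lim_scal cosh), derivable_pt_lim_cosh.
Qed.

Lemma root_defect_increasing (d a b : R) :
  1 < d -> 0 < a -> a < b -> root_defect d a < root_defect d b.
Proof.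
intros Hd Ha Hab.
destruct (MVT_cor2 (root_defect d) _ a b Hab
            (fun c _ => root_defect_derivative d c)) as [c [Hc Hacb]].
assert (sinh c < sinh (d * c)) by (apply sinh_lt; nra).
assert (0 < d * (sinh (d * c) - sinh c)) by (apply Rmult_lt_0_compat; lra).
nra.
Qed.

Lemma root_exists (d : R) : 1 < d -> exists x, is_xi d x.
Proof.
intros Hd.
(* With this [b], [e^(d b) / 2 = d e^b], which already dominates [d cosh b]. *)
set (b := ln (2 * d) / (d - 1)).
assert (Hb : 0 < b).
{ apply Rdiv_lt_0_compat; [|lra].
  rewrite <- ln_1; apply ln_increasing; lra. }
assert (H0 : root_defect d 0 < 0).
{ unfold root_defect; rewrite Rmult_0_r, cosh_0; lra. }
assert (Hpos : 0 < root_defect d b).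
{ unfold root_defect.
  assert (Hexp : exp (d * b) = 2 * d * exp b).
  { replace (d * b) with (ln (2 * d) + b) by (unfold b; field; lra).
    rewrite exp_plus, exp_ln by lra; reflexivity. }
  assert (Hc := cosh_le_exp b ltac:(lra)).
  assert (Hp := exp_pos (- (d * b))).
  unfold cosh at 1; rewrite Hexp; nra. }
assert (Hcont : continuity (root_defect d)).
{ intros z; apply derivable_continuous_pt.
  exists (d * (sinh (d * z) - sinh z)); apply root_defect_derivative. }
destruct (IVT _ 0 b Hcont Hb H0 Hpos) as [z [[Hz _] Heq]].
exists z; split.
- destruct Hz as [Hz | <-]; [exact Hz | lra].
- unfold root_defect in Heq; lra.
Qed.

Lemma root_exists_unique (d : R) : 1 < d -> exists! x, is_xi d x.
Proof.
intros Hd; destruct (root_exists d Hd) as [x [Hx Ex]].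
exists x; split; [split; assumption|].
intros z [Hz Ez].
destruct (Rtotal_order x z) as [H | [H | H]]; [| exact H |];
  apply (root_defect_increasing d) in H; trivial; unfold root_defect in H; lra.
Qed.

Lemma xi_is_root (d : R) : 1 < d -> is_xi d (xi d).
Proof.
intros Hd.
exact (proj1 (epsilon_spec (inhabits 0) _ (root_exists_unique d Hd))).
Qed.

(** * Location of the root *)

Lemma exp_root_ge (d x : R) : 1 < d -> is_xi d x -> d <= exp (d * x).
Proof.
intros Hd [Hx E].
assert (H1 := cosh_ge_1 x).
assert (H2 := cosh_le_exp (d * x) ltac:(nra)).
nra.
Qed.

Lemma exp_neg_root_le (d x : R) : 1 < d -> is_xi d x -> exp (- (d * x)) <= / d.
Proof.
intros Hd Hx; rewrite exp_Ropp.
apply Rinv_le_contravar; [lra | apply exp_root_ge; assumption].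
Qed.

(** In [e^y + e^(-y) = 2 d cosh x], drop [e^(-y)] and use [cosh x <= e^x]. The
    error [x] is the variable itself, so this also bounds [x] a priori:
    [(d - 1) x <= ln (2 d)]. *)
Lemma root_upper (d x : R) : 1 < d -> is_xi d x -> d * x <= ln (2 * d) + x.
Proof.
intros Hd [Hx E].
assert (H : exp (d * x) <= exp (ln (2 * d) + x)).
{ rewrite exp_plus, exp_ln by lra.
  assert (H1 := cosh_le_exp x ltac:(lra)).
  assert (H2 := exp_pos (- (d * x))).
  unfold cosh at 1 in E; nra. }
apply Rnot_lt_le; intros Hlt; apply exp_increasing in Hlt; lra.
Qed.

(** In [e^y + e^(-y) = 2 d cosh x], use [cosh x >= 1] and [e^(-y) <= 1/d]. *)
Lemma root_lower (d x : R) :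
  1 < d -> is_xi d x -> ln (2 * d) - / d ^ 2 <= d * x.
Proof.
intros Hd Hxi; assert (Hy := exp_neg_root_le d x Hd Hxi).
destruct Hxi as [Hx E].
assert (H1 := cosh_ge_1 x).
assert (Hi : 0 < / d ^ 2 <= 1).
{ split; [apply Rinv_0_lt_compat; nra|].
  rewrite <- Rinv_1; apply Rinv_le_contravar; nra. }
(* [t] is the relative size of [e^(-y) <= 1/d] against [2 d]. *)
set (t := / d ^ 2 / 2).
assert (H : 2 * d * (1 - t) <= exp (d * x)).
{ replace (2 * d * (1 - t)) with (2 * d - / d) by (unfold t; field; lra).
  unfold cosh at 1 in E; nra. }
assert (Ht : 0 <= t <= 1 / 2) by (unfold t; lra).
apply ln_le in H; [|nra].
rewrite ln_exp, ln_mult in H by lra.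
assert (Hl := ln_one_sub_ge t Ht).
unfold t in *; lra.
Qed.

(** * The logarithm of gamma *)

(** Write [sinh t = e^t - cosh t] at [x] and [sinh t = cosh t - e^(-t)] at
    [d x]: the two hyperbolic cosines cancel at the root. *)
Lemma sinh_sum_at_root (d x : R) : cosh (d * x) = d * cosh x ->
  sinh (d * x) + d * sinh x = d * exp x - exp (- (d * x)).
Proof. unfold cosh, sinh; intros E; lra. Qed.

Lemma ln_gamma_eq (d : R) : 1 < d ->
  ln (gamma d) =
    xi d - ln d / (d - 1) + ln (1 - exp (- (d * xi d)) * exp (- xi d) / d).
Proof.
intros Hd; assert (Hxi := xi_is_root d Hd).
assert (Hy := exp_neg_root_le d _ Hd Hxi).
destruct Hxi as [Hx E].
unfold gamma; rewrite (sinh_sum_at_root _ _ E).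
set (x := xi d) in *; set (q := exp (- (d * x))) in *.
assert (Hex : 1 < exp x) by (rewrite <- exp_0; apply exp_increasing; lra).
assert (Hd1 : / d < 1) by (rewrite <- Rinv_1; apply Rinv_lt_contravar; lra).
replace (d * exp x - q) with (d * exp x * (1 - q * exp (- x) / d))
  by (rewrite exp_Ropp; field; lra).
assert (Hpos : 0 < 1 - q * exp (- x) / d).
{ apply Rmult_lt_reg_l with (d * exp x); [nra|].
  replace (d * exp x * (1 - q * exp (- x) / d)) with (d * exp x - q)
    by (rewrite exp_Ropp; field; lra).
  nra. }
rewrite !ln_mult; try lra; try (apply exp_pos); try nra.
- unfold Rpower; rewrite !ln_exp; field; lra.
- apply Rmult_lt_0_compat; nra.
Qed.

Lemma ln_gamma_correction (d x : R) : 2 <= d -> is_xi d x ->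
  - 2 * / d ^ 2 <= ln (1 - exp (- (d * x)) * exp (- x) / d) <= 0.
Proof.
intros Hd Hxi; assert (Hy := exp_neg_root_le d x ltac:(lra) Hxi).
destruct Hxi as [Hx E].
assert (Hq := exp_pos (- (d * x))); assert (Hp := exp_pos (- x)).
assert (Hp1 : exp (- x) < 1) by (rewrite <- exp_0; apply exp_increasing; lra).
set (q := exp (- (d * x))) in *; set (p := exp (- x)) in *.
assert (Hid : 0 < / d) by (apply Rinv_0_lt_compat; lra).
assert (Hid2 : / d <= / 2) by (apply Rinv_le_contravar; lra).
assert (Ht : 0 <= q * p / d <= / d ^ 2).
{ replace (/ d ^ 2) with (/ d * / d) by (field; lra).
  unfold Rdiv; split.
  - apply Rmult_le_pos; nra.
  - apply Rmult_le_compat_r; nra. }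
assert (Hsq : / d ^ 2 <= 1 / 2).
{ replace (/ d ^ 2) with (/ d * / d) by (field; lra); nra. }
split.
- assert (H := ln_one_sub_ge (q * p / d) ltac:(lra)); lra.
- assert (H := ln_le_sub_1 (1 - q * p / d) ltac:(lra)); lra.
Qed.

Lemma ln_gamma_asymptotics (d : R) : 3 <= d ->
  Rabs (ln (gamma d) - ln 2 / d) <= 5 * (ln d / d ^ 2).
Proof.
intros Hd; assert (Hxi := xi_is_root d ltac:(lra)).
rewrite ln_gamma_eq by lra.
assert (Hcorr := ln_gamma_correction d _ ltac:(lra) Hxi).
set (c := ln (1 - _)) in *.
assert (Hup := root_upper d _ ltac:(lra) Hxi).
assert (Hlo := root_lower d _ ltac:(lra) Hxi).
rewrite ln_mult in Hup, Hlo by lra.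
destruct Hxi as [Hx _]; set (x := xi d) in *.
assert (HL1 := ln_ge_1 d Hd).
assert (H2 : ln 2 <= ln d) by (apply ln_le; lra).
set (L := ln d) in *; set (l := ln 2) in *.
set (i := / d).
assert (Hi : 0 < i) by (apply Rinv_0_lt_compat; lra).
assert (Hid : i * d = 1) by (unfold i; field; lra).
assert (Hi3 : i <= / 3) by (apply Rinv_le_contravar; lra).
replace (/ d ^ 2) with (i * i) in * by (unfold i; field; lra).
replace (L / d ^ 2) with (L * (i * i)) by (unfold i; field; lra).
replace (l / d) with (l * i) by (unfold i; field; lra).
(* A crude [x = O(L/d)]; it bounds the error term of [root_upper]. *)
assert (Hx4 : x <= 4 * L * i).
{ apply Rmult_le_reg_r with d; [lra|].
  replace (4 * L * i * d) with (4 * L) by (rewrite Rmult_assoc, Hid; ring).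
  nra. }
assert (Hxup : x <= (l + L) * i + 4 * L * (i * i)).
{ replace x with (d * x * i) by (rewrite (Rmult_comm d x), Rmult_assoc,
    (Rmult_comm d i), Hid; ring).
  nra. }
assert (Hxlo : (l + L) * i - i * i * i <= x).
{ replace x with (d * x * i) by (rewrite (Rmult_comm d x), Rmult_assoc,
    (Rmult_comm d i), Hid; ring).
  nra. }
assert (Hfrac : L * i <= L / (d - 1) <= L * i + 2 * (L * (i * i))).
{ replace (L / (d - 1)) with (L * i + L * (i * i) * (d / (d - 1)))
    by (unfold i; field; lra).
  assert (0 <= d / (d - 1) <= 2).
  { split; [apply Rlt_le, Rdiv_lt_0_compat; lra|].
    apply Rmult_le_reg_r with (d - 1); [lra|].
    unfold Rdiv; rewrite Rmult_assoc, Rinv_l by lra; lra. }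
  assert (0 <= L * (i * i)) by (apply Rmult_le_pos; nra).
  split; nra. }
assert (Hii : 0 < i * i) by nra.
assert (HiL : i * i <= L * (i * i)) by nra.
assert (Hiii : i * i * i <= / 3 * (i * i)) by nra.
apply Rabs_le; split; lra.
Qed.

Theorem proposition3p1 :
  (forall d : R, 1 < d -> exists! x : R, 0 < x /\ cosh (d * x) = d * cosh x) /\
  (exists C d0 : R, 0 < C /\ 1 < d0 /\
     forall d : R, d0 <= d ->
       Rabs (log2 (gamma d) - 1 / d) <= C * ((ln d) ^ 2 / d ^ 2)).
Proof.
split; [exact root_exists_unique|].
(* [10 = 5 * 2], since [1 / ln 2 <= 2]; and [3 >= e] ensures [ln d >= 1]. *)
exists 10, 3; split; [lra|]; split; [lra|]; intros d Hd.
assert (H := ln_gamma_asymptotics d Hd).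
assert (Hl2 := ln_lt_2).
assert (HL1 := ln_ge_1 d Hd).
assert (Hi : 0 < / d ^ 2) by (apply Rinv_0_lt_compat; nra).
unfold log2.
replace (ln (gamma d) / ln 2 - 1 / d)
  with ((ln (gamma d) - ln 2 / d) * / ln 2) by (field; lra).
rewrite Rabs_mult, (Rabs_pos_eq (/ ln 2))
  by (apply Rlt_le, Rinv_0_lt_compat; lra).
assert (Hinv : / ln 2 <= 2).
{ apply Rle_trans with (/ / 2); [apply Rinv_le_contravar|]; lra. }
assert (Hsq : ln d / d ^ 2 <= ln d ^ 2 / d ^ 2).
{ apply Rmult_le_compat_r; nra. }
assert (Ha := Rabs_pos (ln (gamma d) - ln 2 / d)).
nra.
Qed.
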